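(* Let $G$ be a connected graph with $m$ edges. Then $\mathrm{scfc}(G)=m-1$ if and only if $G$ is isomorphic to one of the graphs $P_3$, $P_4$, $\Gamma_m$.
   Context: All graphs are finite, simple and undirected. Here $P_n$ denotes the path of length $n$ (that is, with $n$ edges). For $r\geq 2$, let $S_r$ be the star with $r$ edges and let $u$ be a leaf of $S_r$; $\Gamma_{r+1}$ is the graph (with $r+1$ edges) obtained from $S_r$ by adding a new vertex $v$ and the edge $uv$. Thus $\Gamma_m$ has $m$ edges and is defined for $m\geq 3$. Edge-colorings are arbitrary (adjacent edges may receive the same color). A path in an edge-colored graph is conflict-free if some color is used on exactly one of its edges. An edge-colored graph $G$ is strongly conflict-free connected if for every pair of distinct vertices $u,v$ there is a conflict-free path of length $d_G(u,v)$ connecting them. For a connected graph $G$, $\mathrm{scfc}(G)$ is the smallest number of colors in an edge-coloring making $G$ strongly conflict-free connected. *)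

(* Defs.v *)
From HB Require Import structures.
From mathcomp Require Import all_boot all_order all_algebra.

Set Implicit Arguments.
Unset Strict Implicit.
Unset Printing Implicit Defensive.

Record sgraph := SGraph {
  vertex :> finType;
  adj : rel vertex;
  adj_sym : symmetric adj;
  adj_irrefl : irreflexive adj }.

Definition edges (G : sgraph) : {set {set G}} :=
  [set [set x; y] | x in G, y in adj x].

Definition edge (G : sgraph) := {f : {set G} | f \in edges G}.

Definition connected (G : sgraph) : bool :=
  (0 < #|G|) && [forall x : G, forall y : G, connect (@adj G) x y].

Definition iso (G H : sgraph) : Prop :=
  exists2 f : G -> H, bijective f & forall x y, adj (f x) (f y) = adj x y.

(* A walk from x to y is given by the sequence p of its vertices after x, so
   its length (number of edges) is size p; a path is a walk without repeated
   vertices. *)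
Definition is_walk (G : sgraph) (x y : G) (p : seq G) : bool :=
  path (@adj G) x p && (last x p == y).

Definition is_path (G : sgraph) (x y : G) (p : seq G) : bool :=
  is_walk x y p && uniq (x :: p).

(* Least length of a path from x to y (#|G| if there is none); a path has at
   most #|G| - 1 edges. *)
Definition dist (G : sgraph) (x y : G) : nat :=
  find (fun n => [exists p : n.-tuple G, is_path x y p]) (iota 0 #|G|).

(* insub only injects into the subtype of edges: along a walk no pair of
   consecutive vertices is dropped (see path_edgesK). *)
Definition path_edges (G : sgraph) (x : G) (p : seq G) : seq (edge G) :=
  pmap insub (pairmap (fun a b => [set a; b]) x p).

Lemma path_edgesK (G : sgraph) (x : G) (p : seq G) :
  path (@adj G) x p ->
  map val (path_edges x p) = pairmap (fun a b => [set a; b]) x p.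
Proof.
rewrite /path_edges; elim: p x => [|y p IHp] x //= /andP[xy /IHp {}IHp].
have exy : [set x; y] \in edges G by apply/imset2P; exists x y; rewrite ?inE.
by rewrite insubT /= IHp.
Qed.

Definition conflict_free (G : sgraph) (k : nat) (c : {ffun edge G -> 'I_k})
    (x : G) (p : seq G) : bool :=
  [exists a : 'I_k, count (fun f => c f == a) (path_edges x p) == 1].

Definition strongly_conflict_free (G : sgraph) (k : nat)
    (c : {ffun edge G -> 'I_k}) : bool :=
  [forall x : G, forall y : G, (x != y) ==>
    [exists p : (dist x y).-tuple G, is_path x y p && conflict_free c x p]].

Definition scf_colorable (G : sgraph) (k : nat) : bool :=
  [exists c : {ffun edge G -> 'I_k}, strongly_conflict_free c].

Lemma dist_path (G : sgraph) (x y : G) :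
  connect (@adj G) x y -> exists p : (dist x y).-tuple G, is_path x y p.
Proof.
case/connectP=> p0 xp0 ->; case/shortenP: xp0 => p xp Up _.
set P := fun n => [exists q : n.-tuple G, is_path x (last x p) q].
have szp : size p < #|G| by have := max_card (mem (x :: p)); rewrite (card_uniqP Up).
have hasP : has P (iota 0 #|G|).
  apply/hasP; exists (size p); first by rewrite mem_iota.
  by apply/existsP; exists (in_tuple p); rewrite /is_path /is_walk xp eqxx.
have := nth_find 0 hasP; rewrite nth_iota; last first.
  by rewrite -[X in _ < X](size_iota 0 #|G|) -has_find.
by move/existsP.
Qed.

(* Giving all edges distinct colours always works. *)
Lemma scf_colorable_ex (G : sgraph) :
  connected G -> exists k, scf_colorable G k.
Proof.
case/andP=> _ /forallP Gc; exists #|{: edge G}|.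
apply/existsP; exists [ffun f => enum_rank f].
apply/forallP=> x; apply/forallP=> y; apply/implyP=> nxy.
have [p Pp] := dist_path (forallP (Gc x) y).
apply/existsP; exists p; rewrite Pp /=.
case/andP: Pp => /andP[]; case: (tval p) => [|z q] /=.
  by move=> _ xy; rewrite xy in nxy.
move=> /andP[xz _] _ /andP[xzq _].
have exz : [set x; z] \in edges G by apply/imset2P; exists x z; rewrite ?inE.
apply/existsP; exists (enum_rank (Sub [set x; z] exz : edge G)).
rewrite /path_edges /= insubT /= ffunE eqxx add1n eqSS -leqn0 leqNgt -has_count.
apply/hasPn=> f; rewrite mem_pmap_sub ffunE (inj_eq enum_rank_inj) => fq.
apply/negP=> /eqP def_f; move: fq; rewrite def_f /= => {def_f f}.
have: x \in [set x; z] by rewrite !inE eqxx.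
move: [set x; z] => f xf; elim: q z xzq {xz exz} => [|w q IHq] z //=.
rewrite !inE !negb_or => /and3P[xz xw xq] /orP[/eqP def_f|].
  by move: xf; rewrite def_f !inE (negPf xz) (negPf xw).
by apply/negP/negP => /IHq; apply; rewrite inE negb_or xw.
Qed.

Definition scfc (G : sgraph) (Gc : connected G) : nat :=
  ex_minn (scf_colorable_ex Gc).

Section Families.
Variable n : nat.

Definition path_rel : rel 'I_n.+1 :=
  fun i j => (i.+1 == j :> nat) || (j.+1 == i :> nat).
Lemma path_rel_sym : symmetric path_rel.
Proof. by move=> i j; rewrite /path_rel orbC. Qed.
Lemma path_rel_irrefl : irreflexive path_rel.
Proof. by move=> i; rewrite /path_rel orbb gtn_eqF. Qed.

(* The path with n edges, hence n + 1 vertices. *)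
Definition path_graph := SGraph path_rel_sym path_rel_irrefl.

Definition star_rel : rel 'I_n.+1 := fun i j => (i == ord0) (+) (j == ord0).
Lemma star_rel_sym : symmetric star_rel.
Proof. by move=> i j; rewrite /star_rel addbC. Qed.
Lemma star_rel_irrefl : irreflexive star_rel.
Proof. by move=> i; rewrite /star_rel addbb. Qed.

(* The star with n edges and centre ord0. *)
Definition star := SGraph star_rel_sym star_rel_irrefl.

End Families.

Section Pendant.
Variables (G : sgraph) (u : G).

Definition pendant_rel : rel (option G) := fun x y =>
  match x, y with
  | Some a, Some b => adj a b
  | Some a, None => a == u
  | None, Some b => b == u
  | None, None => false
  end.
Lemma pendant_rel_sym : symmetric pendant_rel.
Proof. by case=> [a|] [b|] //=; apply: adj_sym. Qed.
Lemma pendant_rel_irrefl : irreflexive pendant_rel.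
Proof. by case=> [a|] //=; apply: adj_irrefl. Qed.

(* G with a new vertex None joined to u only. *)
Definition add_pendant := SGraph pendant_rel_sym pendant_rel_irrefl.

End Pendant.

(* Meaningful for 3 <= m only: ord_max is then a leaf of the star with m - 1
   edges. *)
Definition Gamma (m : nat) : sgraph := @add_pendant (star m.-1) ord_max.

(* Main.v *)
Require Import Defs.
From mathcomp Require Import all_boot all_order all_algebra.

Set Implicit Arguments.
Unset Strict Implicit.
Unset Printing Implicit Defensive.

(** Giving all m edges distinct colours makes every shortest path conflict-free,
    so scfc is at most m, and the question is how many colours can be saved by
    merging colour classes. A shortest path fails to be conflict-free only if
    each of its edges has a twin, another edge of the path of the same colour
    (geodesic_colorable). If few edges are merged, such a path is short and runs
    entirely inside the merged edges.

    Two colours are saved in each of the following situations. The three edges of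
    a triangle, or three pairwise disjoint edges, can share one colour
    (triangle_saves_two, matching_saves_two), since two consecutive edges of a
    shortest path neither lie in a triangle nor are disjoint. Two pairs of
    disjoint edges can be merged unless the four edges form a shortest path
    (pairs_saves_two); this covers a 4-cycle, a path on five vertices with a
    chord, and two disjoint cherries (a cherry is a vertex with two of its
    neighbours).

    A connected graph containing none of these configurations is very restricted
    (classification). If it has a path on five vertices, then this path is
    induced, and any edge leaving it completes three disjoint edges or two
    disjoint cherries, so the graph is P_4. If its longest path has four
    vertices, then it is a double star, one of whose centres has a single leaf:
    this is Gamma_m, and P_3 = Gamma_3. Otherwise it is a star.

    Conversely, the edges at a vertex c must have distinct colours as soon as any
    two neighbours of c are non-adjacent and have no other common neighbour
    (degree_le_colors). This gives m colours for a star and m - 1 for Gamma_m; for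
    P_4 it forces the colours to alternate if there are only two of them, and then
    the whole path is not conflict-free. Merging two disjoint edges shows that m - 1
    colours suffice for P_4 and Gamma_m. *)

(** * Colourings obtained by merging edges *)

Lemma eq_set2 (T : finType) (a b c d : T) :
  ([set a; b] == [set c; d]) = (a == c) && (b == d) || (a == d) && (b == c).
Proof.
apply/eqP/orP=> [eqS|[] /andP[/eqP-> /eqP->] //]; last by rewrite setUC.
have memE x : (x == a) || (x == b) = ((x == c) || (x == d)).
  by have /setP/(_ x) := eqS; rewrite !inE.
move: (memE a) (memE b) (memE c) (memE d); rewrite !eqxx !orbT /=.
rewrite !(eq_sym c) !(eq_sym d).
by do ?[case: eqP => //= _]; auto.
Qed.

Section Recolouring.
Variable G : sgraph.
Implicit Types (x y z : G) (p : seq G) (e : {set G}).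

Lemma mem_edges x y : ([set x; y] \in edges G) = adj x y.
Proof.
apply/imset2P/idP=> [[a b _ ab /eqP]|xy]; last by exists x y; rewrite ?inE.
have {}ab : adj a b := ab; rewrite eq_set2 => /orP[] /andP[/eqP-> /eqP->] //.
by rewrite adj_sym.
Qed.

Lemma adj_neq x y : adj x y -> x != y.
Proof. by apply: contraTneq => ->; rewrite adj_irrefl. Qed.

Definition edge_sets x p := pairmap (fun a b => [set a; b]) x p.

Lemma edge_sets_sub x p e z : e \in edge_sets x p -> z \in e -> z \in x :: p.
Proof.
elim: p x => //= y p IHp x; rewrite inE => /orP[/eqP->|ep].
  by rewrite !inE orbA => ->.
by move=> ze; rewrite inE (IHp y) ?orbT.
Qed.

Lemma uniq_edge_sets x p : uniq (x :: p) -> uniq (edge_sets x p).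
Proof.
elim: p x => //= y p IHp x /andP[xp Uyp]; rewrite [X in _ && X]IHp // andbT.
by apply: contra xp => /edge_sets_sub; apply; rewrite !inE eqxx.
Qed.

Lemma dist_le x y p : is_walk x y p -> dist x y <= size p.
Proof.
case/andP=> xp /eqP<-; case/shortenP: xp => q xq Uq qp.
have szq : size q < #|G|.
  by have := max_card (mem (x :: q)); rewrite (card_uniqP Uq).
apply: leq_trans (uniq_leq_size (proj2 (andP Uq)) qp).
rewrite leqNgt; apply/negP=> lt_q; have := before_find 0 lt_q.
rewrite nth_iota //= => /existsP[]; exists (in_tuple q).
by rewrite /is_path /is_walk xq eqxx.
Qed.

(** The colours are the values of f, with f acting on all vertex sets to avoid the
    subtype of edges. If some edge of a shortest path has no twin in it, then its
    colour occurs once. *)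
Lemma geodesic_colorable k (f : {set G} -> {set G}) :
    connected G -> #|f @: edges G| <= k ->
    (forall x y p, x != y -> is_path x y p -> size p = dist x y ->
      ~ {in edge_sets x p, forall e,
         exists2 e', e' \in edge_sets x p & e' != e /\ f e' = f e}) ->
  scf_colorable G k.
Proof.
case/andP=> _ /forallP Gc le_k no_twin.
pose col (e : edge G) : 'I_k :=
  widen_ord le_k (enum_rank_in (imset_f f (valP e)) (f (val e))).
have rankK (u : edge G) : _ :=
  enum_rankK_in (imset_f f (valP u)) (imset_f f (valP u)).
have colE (u v : edge G) : (col u == col v) = (f (val u) == f (val v)).
  apply/eqP/eqP=> [/(congr1 val)/= /val_inj eq_r|eq_f].
    by rewrite -(rankK u) eq_r rankK.
  by apply/val_inj => /=; congr val; apply: enum_val_inj; rewrite !rankK.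
apply/existsP; exists [ffun e => col e].
apply/forallP=> x; apply/forallP=> y; apply/implyP=> nxy.
have [p Pp] := dist_path (forallP (Gc x) y).
apply/existsP; exists p; rewrite Pp /=.
have /andP[/andP[xp _] Up] := Pp.
set s := edge_sets x p.
have [/hasP[e es /allP e1]|/hasPn no1] :=
  boolP (has (fun e => all (fun e' => (f e' == f e) ==> (e' == e)) s) s);
  last first.
  case: (no_twin x y p nxy Pp (size_tuple p)) => e /no1/allPn[e' e's].
  by rewrite negb_imply => /andP[/eqP fe ne]; exists e'.
have sK : map val (path_edges x p) = s := path_edgesK xp.
have /mapP[e0 e0p def_e] : e \in map val (path_edges x p) by rewrite sK.
apply/existsP; exists (col e0).
have <- : count (pred1 e) s = 1 by rewrite count_uniq_mem ?es ?uniq_edge_sets.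
rewrite -sK count_map; apply/eqP/eq_in_count=> g gp /=.
rewrite ffunE colE -def_e /=; apply/idP/idP=> [fg|/eqP->] //.
by apply: (implyP (e1 _ _)) fg; rewrite -sK map_f.
Qed.

(** The colour of an edge is represented by an edge of its class: b takes the
    colour of a and d takes the colour of c. The choice a = c puts a, b, d in one
    class, and the choice a = c, b = d merges a single pair. *)
Definition merge (a b c d e : {set G}) :=
  if e == b then a else if e == d then c else e.

Lemma card_merge a b c d :
    a \in edges G :\ b :\ d -> c \in edges G :\ b :\ d ->
  #|merge a b c d @: edges G| <= #|edges G :\ b :\ d|.
Proof.
move=> aE cE; apply/subset_leq_card/subsetP=> _ /imsetP[e eE ->].
rewrite /merge; case: eqVneq => // neb; case: eqVneq => // ned.
by rewrite !inE neb ned.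
Qed.

Lemma merge_inj_out a b c d e e' :
  e \notin [:: a; b; c; d] -> merge a b c d e' = merge a b c d e -> e' = e.
Proof.
rewrite !inE !negb_or /merge => /and4P[/negPf ea /negPf-> /negPf ec /negPf->].
case: eqVneq => [_ /eqP|_]; first by rewrite eq_sym ea.
by case: eqVneq => [_ /eqP|_ //]; rewrite eq_sym ec.
Qed.

(** A shortest path in which every edge has a twin has at least two edges, all of
    them among a, b, c, d; its first two edges x z and z w then satisfy adj x w,
    which is a shortcut. *)
Lemma merge_colorable_of_triangles a b c d :
    connected G ->
    a \in edges G :\ b :\ d -> c \in edges G :\ b :\ d ->
    (forall x z w, x != w -> [set x; z] \in [:: a; b; c; d] ->
       [set z; w] \in [:: a; b; c; d] -> adj x w) ->
  scf_colorable G #|edges G :\ b :\ d|.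
Proof.
move=> Gc aE cE chord; apply: geodesic_colorable Gc (card_merge aE cE) _.
move=> x y p nxy Pp szp twin.
have inD e : e \in edge_sets x p -> e \in [:: a; b; c; d].
  move=> /twin[e' _ [ne fe]]; apply: contraR ne => eD.
  by rewrite (merge_inj_out eD fe).
have /andP[/andP[xp lastp] Up] := Pp.
case: p => [|z [|w q]] in Pp szp twin inD xp lastp Up *.
- by rewrite lastp in nxy.
- have [|e' + [/eqP]] := twin [set x; z]; rewrite inE // => /eqP.
  by [].
have xw : adj x w.
  apply: (chord _ z); try by apply: inD; rewrite !inE eqxx ?orbT.
  by case/and3P: Up; rewrite !inE !negb_or => /and3P[].
have : dist x y <= size (w :: q).
  by apply: dist_le; rewrite /is_walk lastp andbT /= xw; case/and3P: xp.
by rewrite -szp /= ltnn.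
Qed.

(** A shortest path in which every edge has a twin contains one of the pairs
    {a, b}, {c, d} with each of its edges. Its first two edges meet, so they
    belong to different pairs, and the path consists of exactly the four edges
    a, b, c, d. *)
Lemma merge_colorable_of_pairs a b c d :
    connected G -> uniq [:: a; b; c; d] ->
    a \in edges G -> c \in edges G ->
    [disjoint a & b] -> [disjoint c & d] ->
    (forall x0 x1 x2 x3 x4, uniq [:: x0; x1; x2; x3; x4] ->
       {subset [:: [set x0; x1]; [set x1; x2]; [set x2; x3]; [set x3; x4]]
          <= [:: a; b; c; d]} -> dist x0 x4 < 4) ->
  scf_colorable G #|edges G :\ b :\ d|.
Proof.
move=> Gc U4 aE cE ab cd no4.
have := U4; rewrite /= !inE !negb_or andbT.
case/and3P=> /and3P[Nab Nac Nad] /andP[Nbc Nbd] Ncd.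
have {}aE : a \in edges G :\ b :\ d by rewrite !inE Nab Nad.
have {}cE : c \in edges G :\ b :\ d by rewrite !inE (eq_sym c b) Nbc Ncd.
apply: geodesic_colorable Gc (card_merge aE cE) _.
move=> x y p nxy Pp szp twin.
have inD : {subset edge_sets x p <= [:: a; b; c; d]}.
  move=> e /twin[e' _ [ne fe]]; apply: contraR ne => eD.
  by rewrite (merge_inj_out eD fe).
have neqF (u v : {set G}) : u != v -> ((u == v) = false) * ((v == u) = false).
  by move/negPf=> uv; rewrite (eq_sym v).
have nE := (neqF _ _ Nab, neqF _ _ Nac, neqF _ _ Nad, neqF _ _ Nbc,
            neqF _ _ Nbd, neqF _ _ Ncd).
have twin_in e e' : (e, e') \in [:: (a, b); (b, a); (c, d); (d, c)] ->
    e \in edge_sets x p -> e' \in edge_sets x p.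
  move=> ee' /twin[e1 e1s [ne1]]; move: (inD _ e1s) ee'; rewrite !inE /merge.
  case/or4P=> /eqP def1; rewrite def1 in ne1 e1s *;
  case/or4P=> /eqP[? ?]; subst e e' => //; rewrite ?eqxx ?nE in ne1 * => //;
  by move/eqP; rewrite ?nE.
have /andP[/andP[xp lastp] Up] := Pp.
have Us : uniq (edge_sets x p) := uniq_edge_sets Up.
case: p => [|z [|w q]] in Pp szp twin inD xp lastp Up twin_in Us *.
- by rewrite lastp in nxy.
- have [|e' + [/eqP]] := twin [set x; z]; rewrite inE // => /eqP.
  by [].
set s := edge_sets _ _ in twin inD twin_in Us.
have e1s : [set x; z] \in s by rewrite !inE eqxx.
have e2s : [set z; w] \in s by rewrite !inE eqxx orbT.
have Ne : [set x; z] != [set z; w].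
  by case/andP: (Us); rewrite inE negb_or => /andP[].
have szE : size s = size [:: z, w & q] by rewrite size_pairmap.
have inD' : {subset edge_sets x [:: z, w & q] <= [:: a; b; c; d]} := inD.
clearbody s.
have same_ab : (a \in s) = (b \in s).
  by apply/idP/idP; apply: twin_in; rewrite !inE eqxx ?orbT.
have same_cd : (c \in s) = (d \in s).
  by apply/idP/idP; apply: twin_in; rewrite !inE eqxx ?orbT.
(* The first two edges share z, hence do not form a pair of disjoint edges. *)
have meet (u v : {set G}) : [disjoint u & v] ->
    [set x; z] \in [:: u; v] -> [set z; w] \notin [:: u; v].
  move=> uv; move: Ne (set22 x z) (set21 z w).
  move: [set x; z] [set z; w] => f g nfg zf zg Df; apply: contra nfg.
  move: Df zf zg.
  rewrite !inE => /orP[]/eqP-> zu zv /orP[]/eqP def_g; rewrite def_g in zv * => //.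
    by rewrite (disjointFr uv zu) in zv.
  by rewrite (disjointFr uv zv) in zu.
have split4 (u : {set G}) :
    u \in [:: a; b; c; d] -> (u \in [:: a; b]) || (u \in [:: c; d]).
  by rewrite !inE orbA.
have ab_in (u : {set G}) : u \in s -> u \in [:: a; b] -> a \in s.
  by move=> us /[!inE] /orP[]/eqP def_u; move: us; rewrite def_u // same_ab.
have cd_in (u : {set G}) : u \in s -> u \in [:: c; d] -> c \in s.
  by move=> us /[!inE] /orP[]/eqP def_u; move: us; rewrite def_u // same_cd.
have [as_ cs] : a \in s /\ c \in s.
  case/orP: (split4 _ (inD _ e1s)) => D1; case/orP: (split4 _ (inD _ e2s)) => D2.
  - by have := meet _ _ ab D1; rewrite D2.
  - by split; [apply: ab_in D1 | apply: cd_in D2].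
  - by split; [apply: ab_in D2 | apply: cd_in D1].
  - by have := meet _ _ cd D1; rewrite D2.
have szs : size [:: z, w & q] = 4.
  apply/eqP; rewrite -szE eqn_leq (uniq_leq_size Us inD).
  apply: (uniq_leq_size U4) => u; rewrite !inE.
  by case/or4P=> /eqP->; rewrite -?same_ab -?same_cd.
case: q => [|x3 [|x4 [|? ?]]] // in Pp szp twin xp lastp Up inD' szE szs *.
by have := no4 _ _ _ _ _ Up inD'; rewrite [x4](eqP lastp) -szp.
Qed.

End Recolouring.

(** * Configurations that save two colours *)

Ltac split_hyps :=
  repeat match goal with
  | H : is_true (uniq _) |- _ => progress rewrite /= ?inE ?negb_or ?andbT in H
  | H : is_true (_ && _) |- _ =>
      let H1 := fresh in let H2 := fresh in destruct (andP H) as [H1 H2]; clear H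
  | H : is_true (_ != _) |- _ => apply (elimN eqP) in H
  end.

Ltac split_eqs H :=
  lazymatch type of H with
  | is_true (_ || _) =>
      let H1 := fresh in destruct (orP H) as [H1 | H1]; clear H; split_eqs H1
  | is_true (_ && _) =>
      let H1 := fresh in let H2 := fresh in
      destruct (andP H) as [H1 H2]; clear H;
      apply (elimT eqP) in H1; apply (elimT eqP) in H2
  | is_true (_ == _) => apply (elimT eqP) in H
  end.

(** Decides which of a list of edges (or vertices) H names, discarding the cases
    that contradict the disequalities of the context. *)
Ltac edge_cases H :=
  rewrite ?inE ?eq_set2 -?orbA in H; split_eqs H; try congruence.

Ltac neqs :=
  split_hyps; rewrite ?negb_or ?andbT; do ?[apply/andP; split];
  apply/eqP; congruence.

Section SavingTwo.
Variable G : sgraph.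
Hypothesis Gc : connected G.
Implicit Types (x y z v w : G).

Definition saves_two := exists2 k, k.+2 <= #|edges G| & scf_colorable G k.

Lemma saves_twoI (b d : {set G}) :
    b \in edges G -> d \in edges G -> b != d ->
  scf_colorable G #|edges G :\ b :\ d| -> saves_two.
Proof.
move=> bE dE nbd colG; exists #|edges G :\ b :\ d| => //.
by rewrite (cardsD1 b (edges G)) bE (cardsD1 d (edges G :\ b)) !inE eq_sym nbd dE.
Qed.

(** A shortest path uses at most one edge of a triangle. *)
Lemma triangle_saves_two x y z : adj x y -> adj y z -> adj x z -> saves_two.
Proof.
move=> xy yz xz; have /eqP := adj_neq xy; have /eqP := adj_neq yz.
have /eqP := adj_neq xz => nxz nyz nxy.
have [yx zy zx] : [/\ adj y x, adj z y & adj z x] by split; rewrite adj_sym.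
have mem_tri (u v : G) : [set u; v] \in
    [:: [set x; y]; [set y; z]; [set x; y]; [set x; z]] ->
    (u \in [:: x; y; z]) && (v \in [:: x; y; z]).
  move=> H; rewrite !inE.
  by edge_cases H; subst u v; rewrite !eqxx ?orbT.
apply: (@saves_twoI [set y; z] [set x; z]); rewrite ?mem_edges //.
  by apply/negP=> E; edge_cases E.
apply: (@merge_colorable_of_triangles _ [set x; y] _ [set x; y]) => //.
1,2: by rewrite !inE mem_edges xy andbT; apply/andP; split;
     apply/negP=> E; edge_cases E.
move=> u v w /eqP nuw /mem_tri/andP[uT _] /mem_tri/andP[_ wT].
by edge_cases uT; edge_cases wT.
Qed.

(** Consecutive edges of a path meet, so they are never two different edges of a
    matching. *)
Lemma matching_saves_two x0 x1 x2 x3 x4 x5 :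
    uniq [:: x0; x1; x2; x3; x4; x5] -> adj x0 x1 -> adj x2 x3 -> adj x4 x5 ->
  saves_two.
Proof.
move=> U x01 x23 x45; split_hyps.
apply: (@saves_twoI [set x2; x3] [set x4; x5]); rewrite ?mem_edges //.
  by apply/negP=> E; edge_cases E.
apply: (@merge_colorable_of_triangles _ [set x0; x1] _ [set x0; x1]) => //.
1,2: by rewrite !inE mem_edges x01 andbT; apply/andP; split;
     apply/negP=> E; edge_cases E.
move=> u v w /eqP nuw uv vw.
by edge_cases uv; edge_cases vw.
Qed.

Lemma pairs_saves_two a0 a1 b0 b1 c0 c1 d0 d1 :
    let D := [:: [set a0; a1]; [set b0; b1]; [set c0; c1]; [set d0; d1]] in
    uniq D -> {subset D <= edges G} ->
    uniq [:: a0; a1; b0; b1] -> uniq [:: c0; c1; d0; d1] ->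
    (forall x0 x1 x2 x3 x4, uniq [:: x0; x1; x2; x3; x4] ->
       [set x0; x1] \in D -> [set x1; x2] \in D ->
       [set x2; x3] \in D -> [set x3; x4] \in D -> dist x0 x4 < 4) ->
  saves_two.
Proof.
move=> D UD DE Uab Ucd no4.
apply: (@saves_twoI [set b0; b1] [set d0; d1]).
- by apply: DE; rewrite !inE eqxx orbT.
- by apply: DE; rewrite !inE eqxx !orbT.
- by move: UD; rewrite /D /= !inE !negb_or => /and4P[_ /andP[]].
have disj (u0 u1 v0 v1 : G) : uniq [:: u0; u1; v0; v1] ->
    [disjoint [set u0; u1] & [set v0; v1]].
  move=> U; rewrite disjoints_subset subUset !sub1set !inE !negb_or; split_hyps.
  by do ![apply/andP; split]; apply/eqP.
apply: (@merge_colorable_of_pairs _ [set a0; a1] _ [set c0; c1]) => //.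
- by apply: DE; rewrite !inE eqxx.
- by apply: DE; rewrite !inE eqxx !orbT.
- exact: disj.
- exact: disj.
move=> x0 x1 x2 x3 x4 Ux sub.
by apply: (no4 _ x1 x2 x3) Ux _ _ _ _; apply: sub; rewrite !inE eqxx ?orbT.
Qed.

(** Opposite edges get the same colour; a path with four edges visits five
    vertices, too many for the square. *)
Lemma square_saves_two v0 v1 v2 v3 :
    uniq [:: v0; v1; v2; v3] -> adj v0 v1 -> adj v1 v2 -> adj v2 v3 ->
    adj v3 v0 -> saves_two.
Proof.
move=> U v01 v12 v23 v30.
have U' : uniq [:: v1; v2; v3; v0] by rewrite -(rot_uniq 3).
apply: (pairs_saves_two _ _ U U') => [||x0 x1 x2 x3 x4 Ux e0 e1 e2 e3].
- by split_hyps; rewrite /= !inE !negb_or andbT; do ![apply/andP; split];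
     apply/negP=> E; edge_cases E.
- by move=> e; rewrite !inE => /or4P[]/eqP->; rewrite mem_edges.
have : {subset [:: x0; x1; x2; x3; x4] <= [:: v0; v1; v2; v3]}.
  have in4 (x y : G) : [set x; y] \in
     [:: [set v0; v1]; [set v2; v3]; [set v1; v2]; [set v3; v0]] ->
     (x \in [:: v0; v1; v2; v3]) && (y \in [:: v0; v1; v2; v3]).
    by move=> H; rewrite !inE; edge_cases H; subst x y; rewrite !eqxx ?orbT.
  move: e0 e1 e2 e3 => /in4/andP[? ?] /in4/andP[? ?].
  move=> /in4/andP[? ?] /in4/andP[? ?].
  by apply/allP; apply/and5P; split=> //; rewrite andbT.
by move/(uniq_leq_size Ux).
Qed.

(** The colours alternate along the path v0 v1 v2 v3 v4. The only paths using all
    four edges are this one and its reverse, and the chord makes both of them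
    longer than the distance of their ends. *)
Lemma chord_saves_two v0 v1 v2 v3 v4 :
    uniq [:: v0; v1; v2; v3; v4] ->
    adj v0 v1 -> adj v1 v2 -> adj v2 v3 -> adj v3 v4 ->
    [|| adj v0 v2, adj v0 v3, adj v0 v4, adj v1 v3, adj v1 v4 | adj v2 v4] ->
  saves_two.
Proof.
move=> U v01 v12 v23 v34 chord.
have short x0 x1 x2 x3 x4 : adj x0 x1 -> adj x1 x2 -> adj x2 x3 -> adj x3 x4 ->
    [|| adj x0 x2, adj x0 x3, adj x0 x4, adj x1 x3, adj x1 x4 | adj x2 x4] ->
    dist x0 x4 < 4.
  move=> x01 x12 x23 x34.
  have le4 p :
      path (@adj G) x0 p -> last x0 p = x4 -> size p < 4 -> dist x0 x4 < 4.
    move=> xp lp; apply: leq_ltn_trans; apply: dist_le.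
    by rewrite /is_walk xp lp eqxx.
  case/or4P=> [x02|x03|x04|/or3P[x13|x14|x24]].
  - by apply: (le4 [:: x2; x3; x4]); rewrite //= x02 x23 x34.
  - by apply: (le4 [:: x3; x4]); rewrite //= x03 x34.
  - by apply: (le4 [:: x4]); rewrite //= x04.
  - by apply: (le4 [:: x1; x3; x4]); rewrite //= x01 x13 x34.
  - by apply: (le4 [:: x1; x4]); rewrite //= x01 x14.
  - by apply: (le4 [:: x1; x2; x4]); rewrite //= x01 x12 x24.
have d04 : dist v0 v4 < 4 by apply: short chord.
have d40 : dist v4 v0 < 4.
  apply: (short _ v3 v2 v1); rewrite 1?adj_sym //.
  by move: chord; rewrite !(adj_sym v0) !(adj_sym v1) (adj_sym v2);
     do ![case: adj => //=].
apply: (@pairs_saves_two v0 v1 v2 v3 v1 v2 v3 v4) 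
  => [|||| x0 x1 x2 x3 x4 Ux e0 e1 e2 e3].
- by split_hyps; rewrite /= !inE !negb_or andbT; do ![apply/andP; split];
     apply/negP=> E; edge_cases E.
- by move=> e; rewrite !inE => /or4P[]/eqP->; rewrite mem_edges.
- by apply: (subseq_uniq _ U); apply: (prefix_subseq [:: v0; v1; v2; v3] [:: v4]).
- by case/andP: U.
split_hyps.
by edge_cases e0; edge_cases e1; edge_cases e2; edge_cases e3; subst.
Qed.

(** Each edge of one cherry is merged with an edge of the other. Four edges that
    form two vertex-disjoint cherries are not the edges of a path. *)
Lemma cherries_save_two p x x' q y y' :
    uniq [:: p; x; x'; q; y; y'] -> adj p x -> adj p x' -> adj q y -> adj q y' ->
  saves_two.
Proof.
move=> U px px' qy qy'.
apply: (@pairs_saves_two p x q y p x' q y') 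
  => [|||| x0 x1 x2 x3 x4 Ux e0 e1 e2 e3].
- by split_hyps; rewrite /= !inE !negb_or andbT; do ![apply/andP; split];
     apply/negP=> E; edge_cases E.
- by move=> e; rewrite !inE => /or4P[]/eqP->; rewrite mem_edges.
1,2: by split_hyps; rewrite /= !inE !negb_or; do ![apply/andP; split => //]; apply/eqP.
split_hyps.
by edge_cases e0; edge_cases e1; edge_cases e2; edge_cases e3; subst.
Qed.

End SavingTwo.

(** * Necessary colours *)

Section LowerBounds.
Variable G : sgraph.
Implicit Types (x y z v w : G) (p : seq G).

(** A shortest path in which every edge has a twin would consist of the two merged
    edges, which do not meet. *)
Lemma disjoint_edges_save_one x0 x1 x2 x3 :
    connected G -> uniq [:: x0; x1; x2; x3] -> adj x0 x1 -> adj x2 x3 ->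
  scf_colorable G #|edges G|.-1.
Proof.
move=> Gc U x01 x23; split_hyps.
set a := [set x0; x1]; set b := [set x2; x3].
have aE : a \in edges G :\ b :\ b.
  by rewrite !inE mem_edges x01 andbT andbb; apply/negP => E; edge_cases E.
have -> : #|edges G|.-1 = #|edges G :\ b :\ b|.
  by rewrite (cardsD1 b) mem_edges x23 setDDl setUid.
apply: (merge_colorable_of_triangles Gc aE aE) => u v w /eqP nuw uv vw.
by rewrite /a /b in uv vw; edge_cases uv; edge_cases vw.
Qed.

Variables (k : nat) (col : {ffun edge G -> 'I_k}).
Hypothesis scf_col : strongly_conflict_free col.

(** Totalised colouring, which spares proofs that a pair is an edge; it is None
    exactly on the sets that are not edges. *)
Definition hue (e : {set G}) : option 'I_k := omap col (insub e).

Lemma hue_edge x y : adj x y -> exists i, hue [set x; y] = Some i.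
Proof.
rewrite -mem_edges /hue => xyE; rewrite insubT /=.
by exists (col (Sub [set x; y] xyE)).
Qed.

Lemma scf_geodesic x y : x != y ->
  exists p, [/\ is_path x y p, size p = dist x y &
    exists a, count (fun e => hue e == Some a) (edge_sets x p) = 1].
Proof.
move=> nxy; have /forallP/(_ x)/forallP/(_ y)/implyP/(_ nxy) := scf_col.
case/existsP=> p /andP[Pp /existsP[a /eqP <-]]; exists p.
split=> //; first exact: size_tuple.
exists a; rewrite /path_edges -/(edge_sets x p); elim: (edge_sets x p) => //= e s ->.
by rewrite /hue; case: (insub e).
Qed.

(** The path x z y is then the only shortest path from x to y. *)
Lemma hue_neq x z y :
    adj x z -> adj z y -> x != y -> ~~ adj x y ->
    (forall t, adj x t -> adj t y -> t = z) ->
  hue [set x; z] != hue [set z; y].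
Proof.
move=> xz zy nxy not_xy common.
have [p [/andP[/andP[xp /eqP lastp] _] szp [a]]] := scf_geodesic nxy.
have : dist x y <= size [:: z; y].
  by apply: dist_le; rewrite /is_walk /= xz zy eqxx.
rewrite -szp; case: p xp lastp {szp} => [|u [|t [|? ?]]] //=.
  by move=> /andP[xu _] def_y; rewrite def_y (negPf not_xy) in xu.
move=> /and3P[xu ut _] def_t _; rewrite def_t in ut *.
rewrite (common u) // => cnt; apply/eqP=> eq_hue; move: cnt.
by rewrite eq_hue; case: eqP.
Qed.

Definition unlinked c := forall x y, adj c x -> adj c y -> x != y ->
  ~~ adj x y /\ forall z, adj x z -> adj z y -> z = c.

(** Any two edges at c form the unique shortest path between their other ends, so
    their colours differ. *)
Lemma degree_le_colors c : unlinked c -> #|[set x | adj c x]| <= k.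
Proof.
move=> cP.
have <- : #|hue @: [set [set c; x] | x in [set x | adj c x]]|
          = #|[set x | adj c x]|.
  rewrite -imset_comp card_in_imset // => x y; rewrite !inE /= => cx cy eq_hue.
  apply/eqP/negPn/negP => nxy; have [nadj common] := cP x y cx cy nxy.
  have := @hue_neq x c y; rewrite (setUC [set x]) eq_hue eqxx adj_sym.
  by move=> /(_ cx cy nxy nadj common).
rewrite -[X in _ <= X]card_ord -(card_imset 'I_k (@Some_inj _)).
apply/subset_leq_card/subsetP=> _ /imsetP[_ /imsetP[x + ->] ->]; rewrite inE.
by case/hue_edge=> i ->; apply: imset_f.
Qed.

(** The hypotheses describe the path with four edges. Consecutive edges have
    different colours by hue_neq, so two colours would alternate, and each of them
    would occur twice on the whole path, which is the only one from v0 to v4. *)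
Lemma five_vertex_path_ge3_colors v0 v1 v2 v3 v4 :
    uniq [:: v0; v1; v2; v3; v4] ->
    adj v0 =1 pred1 v1 -> adj v1 =1 pred2 v0 v2 -> adj v2 =1 pred2 v1 v3 ->
    adj v3 =1 pred2 v2 v4 -> adj v4 =1 pred1 v3 ->
  2 < k.
Proof.
move=> U A0 A1 A2 A3 A4; rewrite ltnNge; apply/negP=> le_k2.
have [p [/andP[/andP[xp /eqP lastp] Up] _ [a]]] :
  exists p, [/\ is_path v0 v4 p, size p = dist v0 v4 &
    exists a, count (fun e => hue e == Some a) (edge_sets v0 p) = 1].
  by apply: scf_geodesic; split_hyps; apply/eqP.
have -> : p = [:: v1; v2; v3; v4].
  move: xp lastp Up; case: p => [_ /= def|x1 p] /=; first by split_hyps; congruence.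
  rewrite A0 => /andP[/eqP->].
  case: p => [_ /= def|x2 p] /=; first by split_hyps; congruence.
  rewrite A1 => /andP[/pred2P[]->]; first by rewrite !inE eqxx !orbT.
  case: p => [_ /= def|x3 p] /=; first by split_hyps; congruence.
  rewrite A2 => /andP[/pred2P[]->]; first by rewrite !inE eqxx !(orbT, andbF).
  case: p => [_ /= def|x4 p] /=; first by split_hyps; congruence.
  rewrite A3 => /andP[/pred2P[]->]; first by rewrite !inE eqxx !(orbT, andbF).
  case: p => [|x5 p] //=.
  by rewrite A4 => /andP[/eqP->]; rewrite !inE eqxx !(orbT, andbF).
have h01 : hue [set v0; v1] != hue [set v1; v2].
  apply: hue_neq; rewrite ?A0 ?A1 /= ?eqxx ?orbT //; try by neqs.
  by move=> t; rewrite A0 => /eqP.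
have h12 : hue [set v1; v2] != hue [set v2; v3].
  apply: hue_neq; rewrite ?A1 ?A2 /= ?eqxx ?orbT //; try by neqs.
  by move=> t; rewrite A1 => /pred2P[]-> //; rewrite A0 => /eqP; split_hyps; congruence.
have h23 : hue [set v2; v3] != hue [set v3; v4].
  apply: hue_neq; rewrite ?A2 ?A3 /= ?eqxx ?orbT //; try by neqs.
  move=> t; rewrite A2 => /pred2P[]-> //; rewrite A1 => /pred2P.
  by split_hyps; case; congruence.
move: h01 h12 h23 => /=.
have [|c0 ->] := @hue_edge v0 v1; first by rewrite A0 /= eqxx.
have [|c1 ->] := @hue_edge v1 v2; first by rewrite A1 /= eqxx orbT.
have [|c2 ->] := @hue_edge v2 v3; first by rewrite A2 /= eqxx orbT.
have [|c3 ->] := @hue_edge v3 v4; first by rewrite A3 /= eqxx orbT.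
have lt2 (i : 'I_k) : i < 2 by apply: leq_trans le_k2.
rewrite !(inj_eq (@Some_inj _)) -!val_eqE /=.
move: (lt2 c0) (lt2 c1) (lt2 c2) (lt2 c3) (lt2 a).
by case: (val c0) => [|[|]]; case: (val c1) => [|[|]]; case: (val c2) => [|[|]];
   case: (val c3) => [|[|]]; case: (val a) => [|[|]].
Qed.

End LowerBounds.

(** * Isomorphisms and the target graphs *)

Section Iso.

Lemma iso_sym (G H : sgraph) : iso G H -> iso H G.
Proof.
case=> f [g fK gK] fA; exists g; first by exists f.
by move=> x y; rewrite -fA !gK.
Qed.

Lemma iso_trans (G H K : sgraph) : iso G H -> iso H K -> iso G K.
Proof.
move=> [f fB fA] [g gB gA]; exists (g \o f); first exact: bij_comp.
by move=> x y /=; rewrite gA fA.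
Qed.

Lemma edges_image (G H : sgraph) (f : G -> H) :
    bijective f -> (forall x y, adj (f x) (f y) = adj x y) ->
  edges H = [set f @: e | e : {set G} in edges G].
Proof.
move=> [g fK gK] fA; apply/setP=> e.
apply/idP/imsetP=> [/imset2P[u v _ uv def_e]|[_ /imset2P[x y _ xy ->] ->]].
  exists [set g u; g v]; last by rewrite imsetU1 imset_set1 !gK.
  by rewrite mem_edges -fA !gK.
by rewrite imsetU1 imset_set1 mem_edges fA.
Qed.

Lemma iso_card_edges (G H : sgraph) : iso G H -> #|edges G| = #|edges H|.
Proof.
move=> [f fB fA]; rewrite (edges_image fB fA) card_imset //.
exact/imset_inj/bij_inj.
Qed.

Lemma unlinked_iso (G H : sgraph) (f : G -> H) c :
    injective f -> (forall x y, adj (f x) (f y) = adj x y) ->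
  unlinked (f c) -> unlinked c.
Proof.
move=> f_inj fA cP x y cx cy nxy; have := cP (f x) (f y).
rewrite !fA (inj_eq f_inj) => /(_ cx cy nxy)[-> common]; split=> // z xz zy.
by apply: f_inj; apply: common; rewrite fA.
Qed.

Lemma card_edges_path n : #|edges (path_graph n)| = n.
Proof.
pose E (i : 'I_n) : {set path_graph n} := [set widen_ord (leqnSn n) i; lift ord0 i].
have -> : edges (path_graph n) = [set E i | i in 'I_n].
  apply/setP=> e; apply/imset2P/imsetP=> [[i j _ ij ->]|[i _ ->]]; last first.
    exists (widen_ord (leqnSn n) i) (lift ord0 i); rewrite ?inE //.
    by rewrite -topredE /= /path_rel /= eqxx.
  wlog ij : i j {ij} / i.+1 = j.
    have {}ij : path_rel i j := ij.
    move=> th; case/orP: ij => /eqP; first exact: th.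
    by rewrite setUC; apply: th.
  have lt_in : i < n by rewrite -ltnS ij ltn_ord.
  exists (Ordinal lt_in) => //; congr [set _; _]; apply: val_inj => //=.
rewrite card_imset ?card_ord // => i j /eqP; rewrite eq_set2.
case/orP=> /andP[/eqP/(congr1 val)/= eq1 /eqP/(congr1 val)/=].
  by move=> _; apply: val_inj.
rewrite /bump !add1n in eq1 * => jE.
by have := leqnn j; rewrite -{1}jE eq1 ltnNge leqnSn.
Qed.

Lemma unlinked_Gamma_center m : 3 <= m -> @unlinked (Gamma m) (Some ord0).
Proof.
move=> m3; have ord0N : (ord0 == ord_max :> 'I_m.-1.+1) = false.
  by rewrite -val_eqE /=; case: m m3 => [|[|]].
move=> [i|] [j|]; rewrite /= ?ord0N // /star_rel /= => i0 j0 nij.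
move: (i0) (j0) => /negPf i0F /negPf j0F.
rewrite i0F j0F; split=> // -[z|] /=; first by move=> /eqP->.
by move=> /eqP im /eqP jm; rewrite im jm eqxx in nij.
Qed.

Lemma degree_Gamma_center m : m.-1 <= #|[set y | @adj (Gamma m) (Some ord0) y]|.
Proof.
rewrite -[X in X <= _]card_ord.
have inj : injective (fun j : 'I_m.-1 => Some (lift ord0 j)).
  by apply: inj_comp; [apply: Some_inj | apply: lift_inj].
rewrite -(card_imset 'I_m.-1 inj); apply/subset_leq_card/subsetP=> _ /imsetP[j _ ->].
by rewrite inE.
Qed.

Lemma Gamma_colors (G : sgraph) m k :
  3 <= m -> iso G (Gamma m) -> scf_colorable G k -> m.-1 <= k.
Proof.
move=> m3 [f [g fK gK] fA] /existsP[col /degree_le_colors le_k].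
have f_inj := can_inj fK.
apply: leq_trans (le_k (g (Some ord0)) _); last first.
  by apply: (unlinked_iso f_inj fA); rewrite gK; apply: unlinked_Gamma_center.
apply: leq_trans (degree_Gamma_center m) _.
rewrite -(card_imset _ (can_inj gK)); apply/subset_leq_card/subsetP=> _ /imsetP[y + ->].
by rewrite !inE -fA !gK.
Qed.

Lemma Gamma_colorable (G : sgraph) m :
    connected G -> 3 <= m -> iso G (Gamma m) -> #|edges G| = m ->
  scf_colorable G m.-1.
Proof.
case: m => [|[|[|m]]] // Gc _ [f [g fK gK] fA] <-.
pose x : Gamma m.+3 := Some ord0; pose y : Gamma m.+3 := Some (lift ord0 ord0).
apply: (@disjoint_edges_save_one _ (g x) (g y) (g (Some ord_max)) (g None)) => //.
- by rewrite (map_inj_uniq (can_inj gK) [:: x; y; Some ord_max; None]).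
- by rewrite -fA !gK.
- by rewrite -fA !gK /= eqxx.
Qed.

End Iso.

(** A double star with centres v1 and v2, where v3 is the only leaf at v2. The
    vertex v1 is the centre of the star, v2 its distinguished leaf and v3 the
    pendant vertex; the other leaves of v1 are numbered arbitrarily. *)
Lemma iso_Gamma (G : sgraph) (v0 v1 v2 v3 : G) :
    uniq [:: v0; v1; v2; v3] -> adj v1 v0 -> adj v1 v2 -> adj v2 v3 ->
    (forall x, x = v1 \/ x = v3 \/ adj v1 x) ->
    (forall x y, adj v1 x -> x <> v2 -> adj x y -> y = v1) ->
    (forall y, adj v2 y -> y = v1 \/ y = v3) ->
    (forall y, adj v3 y -> y = v2) ->
  3 <= #|edges G| /\ iso G (Gamma #|edges G|).
Proof.
move=> U v10 v12 v23 allG leaf adj2 adj3.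
pose N := [set x | adj v1 x].
have not13 : ~~ adj v3 v1 by apply/negP=> /adj3; split_hyps; congruence.
have n0 : 2 <= #|N|.
  have <- : #|[set v0; v2]| = 2 by rewrite cards2; have -> : v0 != v2 by neqs.
  by apply/subset_leq_card/subsetP=> x; rewrite !inE => /pred2P[]->.
have mE : #|edges G| = #|N|.+1.
  have -> : edges G = [set v2; v3] |: [set [set v1; x] | x in N].
    apply/setP=> e; apply/idP/setU1P=> [/imset2P[x y _ xy ->]|[->|]].
    - have {}xy : adj x y := xy.
      have edge1 u : adj v1 u -> [set v1; u] \in [set [set v1; x] | x in N].
        by move=> v1u; apply: imset_f; rewrite inE.
      case: (allG x) => [x1|[x3|v1x]]; first by right; rewrite x1 edge1 -?x1.
        by left; rewrite x3 (adj3 y) -?x3 // setUC.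
      have [x2|/eqP nx2] := eqVneq x v2; last first.
        by right; rewrite (leaf x y v1x nx2 xy) setUC edge1.
      rewrite x2 in xy *; case: (adj2 y xy) => ->; last by left.
      by right; rewrite setUC edge1.
    - by rewrite mem_edges.
    by case/imsetP=> x; rewrite inE => v1x ->; rewrite mem_edges.
  rewrite cardsU1 card_in_imset; last first.
    move=> x y; rewrite !inE => /adj_neq/eqP n1x /adj_neq/eqP n1y /eqP eqxy.
    by edge_cases eqxy.
  rewrite (_ : _ \notin _) //; apply/imsetP=> -[x _ /eqP eqx].
  by split_hyps; edge_cases eqx.
split; first by rewrite mE.
have cardG : #|G| = #|N|.+2.
  have -> : #|G| = #|v1 |: (v3 |: N)|.
    rewrite -cardsT; apply: eq_card => x; rewrite !inE.
    by case: (allG x) => [->|[->|->]]; rewrite ?eqxx ?orbT.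
  rewrite !cardsU1 !inE adj_irrefl orbF adj_sym (negPf not13).
  by have -> : v1 != v3 by neqs.
set m := #|edges G| in mE *.
(* Positions in s are the vertices of the star: v1 is first and v2 is last, to
   match ord0 and ord_max. *)
pose s := v1 :: rcons (enum (N :\ v2)) v2.
have Us : uniq s.
  rewrite /s /= rcons_uniq enum_uniq mem_rcons !inE !mem_enum !inE eqxx.
  by rewrite adj_irrefl andbF orbF; have -> : v1 != v2 by neqs.
have szs : size s = m.
  by rewrite /= size_rcons -cardE mE (cardsD1 v2 N) inE v12.
have memS x : (x \in s) = (x != v3).
  rewrite /s inE mem_rcons inE mem_enum !inE.
  have [->|nx3] := eqVneq x v3.
    by rewrite adj_sym (negPf not13) andbF orbF; apply/negbTE; neqs.
  case: (allG x) => [->|[def|->]]; rewrite ?eqxx ?andbT ?orbN ?orbT //.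
  by rewrite def eqxx in nx3.
have eq_index x y : x != v3 -> y != v3 -> index x s = index y s -> x = y.
  by rewrite -!memS => xs ys eq_i; apply: (@index_inj _ v0 s x y xs ys eq_i).
have lt_index x : x != v3 -> index x s < m.-1.+1.
  by move=> nx3; rewrite prednK ?mE // -mE -szs index_mem memS.
pose f x : Gamma m := if x == v3 then None else Some (inord (index x s)).
have fN x : x != v3 -> f x = Some (inord (index x s)).
  by rewrite /f => /negPf->.
have f3 : f v3 = None by rewrite /f eqxx.
have center x : x != v3 -> (inord (index x s) == ord0 :> 'I_m.-1.+1) = (x == v1).
  move=> nx3; rewrite -val_eqE /= inordK ?lt_index // /s /=.
  by rewrite (eq_sym x); case: (v1 == x).
have last2 : index v2 s = m.-1.
  rewrite -szs /s /= (_ : (v1 == v2) = false); last by apply/negbTE; neqs.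
  by rewrite -cats1 index_cat mem_enum !inE eqxx /= eqxx addn0 size_cat addn1.
have leafE x : x != v3 -> (inord (index x s) == ord_max :> 'I_m.-1.+1) = (x == v2).
  move=> nx3; rewrite -val_eqE /= inordK ?lt_index // -last2.
  apply/eqP/eqP=> [|-> //]; apply: eq_index => //; neqs.
exists f.
  apply: inj_card_bij; last by rewrite card_option card_ord cardG mE.
  move=> x y; rewrite /f; case: eqP => [->|/eqP nx3]; case: eqP => [->|/eqP ny3] //.
  case=> /(congr1 val); rewrite /= !inordK ?lt_index //.
  exact: eq_index.
have adj3E x : x != v3 -> adj x v3 = (x == v2).
  move=> nx3; apply/idP/eqP=> [|-> //]; rewrite adj_sym; exact: adj3.
move=> x y; have [->|nx3] := eqVneq x v3; have [->|ny3] := eqVneq y v3.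
- by rewrite f3 !adj_irrefl.
- by rewrite f3 fN //= leafE // adj_sym adj3E.
- by rewrite f3 fN //= leafE // adj3E.
rewrite !fN //= /star_rel !center //.
have N1 u : u != v3 -> u != v1 -> adj v1 u.
  by move=> /eqP nu3 /eqP nu1; case: (allG u) => [|[]].
have [->|nx1] := eqVneq x v1; have [->|ny1] := eqVneq y v1.
- by rewrite adj_irrefl.
- by rewrite N1.
- by rewrite adj_sym N1.
symmetry; apply/negP=> xy; have [x2|/eqP nx2] := eqVneq x v2.
  rewrite x2 in xy; case: (adj2 y xy) => def_y.
    by rewrite def_y eqxx in ny1.
  by rewrite def_y eqxx in ny3.
by have := leaf x y (N1 x nx3 nx1) nx2 xy; move/eqP; rewrite (negPf ny1).
Qed.

Lemma path3_Gamma : iso (path_graph 3) (Gamma 3).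
Proof.
pose v i : path_graph 3 := inord i.
have vE i : i < 4 -> v i = i :> nat by move=> ?; rewrite /v inordK.
have := @iso_Gamma (path_graph 3) (v 0) (v 1) (v 2) (v 3).
rewrite card_edges_path => th.
have eqv (x : path_graph 3) i : i < 4 -> x = i :> nat -> x = v i.
  by move=> lti xi; apply: val_inj; rewrite /= vE.
have [||||||||_ //] := th.
- by rewrite /= !inE -!val_eqE /= !vE.
- by rewrite /= /path_rel !vE.
- by rewrite /= /path_rel !vE.
- by rewrite /= /path_rel !vE.
- by move=> [[|[|[|[|?]]]] lt] //; rewrite /= /path_rel !vE //=;
    [right; right | left; apply: eqv | right; right | right; left; apply: eqv].
- move=> [[|[|[|[|?]]]] lt] y //; rewrite /= /path_rel !vE //= => _ nx.
    by case/orP=> /eqP // y1; apply: eqv.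
  by case: nx; apply: eqv.
- by move=> [[|[|[|[|?]]]] lt]; rewrite /= /path_rel !vE //= => _;
    [left | right]; apply: eqv.
- by move=> [[|[|[|[|?]]]] lt]; rewrite /= /path_rel !vE //= => _; apply: eqv.
Qed.

(** * Graphs in which two colours cannot be saved *)

Section Classification.
Variable G : sgraph.
Hypothesis Gc : connected G.
Implicit Types (x y z v w : G).

Lemma connected_closed (P : pred G) x :
  P x -> (forall y z : G, P y -> adj y z -> P z) -> forall y, P y.
Proof.
move=> Px closedP y; case/andP: Gc => _ /forallP/(_ x)/forallP/(_ y)/connectP[p].
elim: p x Px => [|z p IHp] x Px /=; first by move=> _ ->.
by case/andP=> /(closedP _ _ Px)/IHp.
Qed.

(** The centre c is a vertex of maximal degree. If a neighbour x of c had another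
    neighbour y, then c would have no neighbour besides x, as x' c x y would be a
    path; but then x would have larger degree than c. *)
Lemma star_of_no_path :
    (forall x y z : G, adj x y -> adj y z -> ~~ adj x z) ->
    (forall x y z t : G, adj x y -> adj y z -> adj z t -> ~~ uniq [:: x; y; z; t]) ->
  exists c : G, unlinked c /\ #|edges G| <= #|[set x : G | adj c x]|.
Proof.
move=> notri nopath; have /andP[/card_gt0P[x0 _] _] := Gc.
pose deg x := #|[set y | adj x y]|.
have [c _ maxc] := @arg_maxnP G x0 predT deg isT.
have leaf x y : adj c x -> adj x y -> y = c.
  move=> cx xy; apply/eqP/negPn/negP=> nyc.
  have deg1 x' : adj c x' -> x' = x.
    move=> cx'; apply/eqP/negPn/negP=> nx'.
    have := nopath x' c x y; rewrite adj_sym cx' => /(_ isT cx xy)/negP; apply.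
    have ncx := adj_neq cx; have ncx' := adj_neq cx'; have nxy := adj_neq xy.
    have nx'y : x' != y.
      by apply: contraTneq xy => <-; apply: (notri _ c); rewrite // adj_sym.
    by split_hyps; rewrite /= !inE; neqs.
  have : deg x <= deg c := maxc x isT; rewrite leqNgt => /negP; apply.
  rewrite /deg (_ : [set y | adj c y] = [set x]); last first.
    by apply/setP=> u; rewrite !inE; apply/idP/eqP=> [/deg1 | ->].
  rewrite cards1; have <- : #|[set c; y]| = 2 by rewrite cards2 eq_sym nyc.
  by apply/subset_leq_card/subsetP=> u; rewrite !inE => /pred2P[]->; rewrite // adj_sym.
have allG : forall x, (x == c) || adj c x.
  apply: (connected_closed (x := c)); first by rewrite eqxx.
  move=> x y /predU1P[->|cx] xy; first by rewrite xy orbT.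
  by rewrite (leaf x y) ?eqxx.
exists c; split=> [x y cx cy nxy|].
  split=> [|z xz zy]; last exact: leaf xz.
  by apply: (notri _ c); rewrite // adj_sym.
rewrite -(card_in_imset (f := fun x => [set c; x])); last first.
  move=> x y; rewrite !inE => /adj_neq/eqP ncx /adj_neq/eqP ncy /eqP eqxy.
  by edge_cases eqxy.
apply/subset_leq_card/subsetP=> _ /imset2P[x y _ xy ->].
have {}xy : adj x y := xy.
have edge_c u : adj c u -> [set c; u] \in [set [set c; z] | z in [set z | adj c z]].
  by move=> cu; apply: imset_f; rewrite inE.
have [xc|nxc] := eqVneq x c; first by rewrite xc edge_c // -xc.
have cx : adj c x by have := allG x; rewrite (negPf nxc).
by rewrite (leaf x y cx xy) setUC edge_c.
Qed.

(** An edge that leaves an induced path on five vertices at an end or in the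
    middle yields three disjoint edges, and at w1 or w3 two disjoint cherries. *)
Lemma path5_saves_two_or_path4 w0 w1 w2 w3 w4 :
    uniq [:: w0; w1; w2; w3; w4] ->
    adj w0 w1 -> adj w1 w2 -> adj w2 w3 -> adj w3 w4 ->
  saves_two G \/ iso G (path_graph 4).
Proof.
move=> U a01 a12 a23 a34; set W := [:: w0; w1; w2; w3; w4].
have [chord|] := boolP
  [|| adj w0 w2, adj w0 w3, adj w0 w4, adj w1 w3, adj w1 w4 | adj w2 w4].
  by left; exact: (chord_saves_two Gc U a01 a12 a23 a34 chord).
rewrite !negb_or => /and5P[c02 c03 c04 c13 /andP[c14 c24]].
have [/existsP[x /existsP[y /and3P[xW xy yW]]]|/existsPn closedW] :=
  boolP [exists x, exists y, [&& x \in W, adj x y & y \notin W]].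
  left; have yx : adj y x by rewrite adj_sym.
  have [a10 a21 a32 a43] : [/\ adj w1 w0, adj w2 w1, adj w3 w2 & adj w4 w3].
    by split; rewrite adj_sym.
  have nyx := adj_neq yx.
  rewrite /W in xW yW; rewrite !inE !negb_or in xW yW; split_hyps.
  split_eqs xW; subst x.
  - apply: (@matching_saves_two _ Gc y w0 w1 w2 w3 w4) => //.
    by rewrite /= !inE; neqs.
  - apply: (@cherries_save_two _ Gc w1 w0 y w3 w2 w4) => //.
    by rewrite /= !inE; neqs.
  - apply: (@matching_saves_two _ Gc w0 w1 w2 y w3 w4) => //.
    by rewrite /= !inE; neqs.
  - apply: (@cherries_save_two _ Gc w3 w4 y w1 w0 w2) => //.
    by rewrite /= !inE; neqs.
  - apply: (@matching_saves_two _ Gc w0 w1 w2 w3 w4 y) => //.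
    by rewrite /= !inE; neqs.
right; have allW : forall x, x \in W.
  apply: (connected_closed (x := w0)); first by rewrite inE eqxx.
  move=> x y xW xy; apply/negPn/negP=> yW.
  by have /existsPn/(_ y) := closedW x; rewrite xW xy yW.
apply: iso_sym; exists (fun i : path_graph 4 => nth w0 W i).
  apply: inj_card_bij.
    by move=> i j /eqP; rewrite nth_uniq // => /eqP/val_inj.
  rewrite card_ord; have <- : #|W| = 5 := card_uniqP U.
  apply/subset_leq_card/subsetP=> x _.
  exact: allW.
move=> i j; rewrite [RHS]/adj /= /path_rel.
by case: i j => [[|[|[|[|[|?]]]]] ?] [[|[|[|[|[|?]]]]] ?] //=;
  rewrite ?adj_irrefl //; first [apply/negbTE | idtac]; rewrite // adj_sym.
Qed.

(** Any other neighbour y of x would either start the path y x v1 v2 v3 or close a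
    triangle or a square. *)
Lemma leaf_of_path v1 v2 v3 x y :
    (forall x y z : G, adj x y -> adj y z -> ~~ adj x z) ->
    (forall w0 w1 w2 w3 : G, uniq [:: w0; w1; w2; w3] ->
       adj w0 w1 -> adj w1 w2 -> adj w2 w3 -> ~~ adj w3 w0) ->
    (forall w0 w1 w2 w3 w4 : G, adj w0 w1 -> adj w1 w2 -> adj w2 w3 -> adj w3 w4 ->
       ~~ uniq [:: w0; w1; w2; w3; w4]) ->
    adj v1 v2 -> adj v2 v3 -> v1 != v3 ->
  adj v1 x -> x <> v2 -> adj x y -> y = v1.
Proof.
move=> notri nosq nop5 v12 v23 n13 v1x /eqP nx2 xy; apply/eqP/negPn/negP=> nyv1.
have xv1 : adj x v1 by rewrite adj_sym.
have nx3 : x != v3 by apply: contraTneq v1x => ->; apply: notri v12 v23.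
have ny2 : y != v2 by apply: contraTneq xy => ->; apply: notri xv1 v12.
have n12 := adj_neq v12; have n23 := adj_neq v23; have n1x := adj_neq v1x.
have nxy := adj_neq xy.
have ny3 : y != v3.
  apply: contraTneq xy => ->; rewrite adj_sym; apply: (nosq x v1 v2 v3) => //.
  by rewrite /= !inE; neqs.
have := nop5 y x v1 v2 v3; rewrite (adj_sym y) => /(_ xy xv1 v12 v23)/negP.
by apply; rewrite /= !inE; neqs.
Qed.

(** The first case is that of a star. *)
Lemma classification :
  [\/ exists c : G, unlinked c /\ #|edges G| <= #|[set x : G | adj c x]|,
      saves_two G, iso G (path_graph 4)
    | 3 <= #|edges G| /\ iso G (Gamma #|edges G|)].
Proof.
have [/existsP[x /existsP[y /existsP[z /and3P[xy yz xz]]]]|notri] :=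
  boolP [exists x : G, exists y : G, exists z : G, [&& adj x y, adj y z & adj x z]].
  by constructor 2; exact: (triangle_saves_two Gc xy yz xz).
have {}notri x y z : adj x y -> adj y z -> ~~ adj x z.
  move=> xy yz; apply: contra notri => xz.
  apply/existsP; exists x; apply/existsP; exists y.
  by apply/existsP; exists z; apply/and3P.
have [/existsP[w0 /existsP[w1 /existsP[w2 /existsP[w3 /and5P[U a01 a12 a23 a30]]]]]|nosq] :=
  boolP [exists w0 : G, exists w1 : G, exists w2 : G, exists w3 : G,
    [&& uniq [:: w0; w1; w2; w3], adj w0 w1, adj w1 w2, adj w2 w3 & adj w3 w0]].
  by constructor 2; exact: (square_saves_two Gc U a01 a12 a23 a30).
have {}nosq w0 w1 w2 w3 : uniq [:: w0; w1; w2; w3] ->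
    adj w0 w1 -> adj w1 w2 -> adj w2 w3 -> ~~ adj w3 w0.
  move=> U a01 a12 a23; apply: contra nosq => a30.
  apply/existsP; exists w0; apply/existsP; exists w1; apply/existsP; exists w2.
  by apply/existsP; exists w3; apply/and5P.
have [/existsP[w0 /existsP[w1 /existsP[w2 /existsP[w3 /existsP[w4]]]]]|nop5] :=
  boolP [exists w0 : G, exists w1 : G, exists w2 : G, exists w3 : G, exists w4 : G,
    [&& uniq [:: w0; w1; w2; w3; w4], adj w0 w1, adj w1 w2, adj w2 w3 & adj w3 w4]].
  case/and5P=> U a01 a12 a23 a34.
  have [] := path5_saves_two_or_path4 U a01 a12 a23 a34.
    by constructor 2.
  by constructor 3.
have {}nop5 w0 w1 w2 w3 w4 : adj w0 w1 -> adj w1 w2 -> adj w2 w3 -> adj w3 w4 ->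
    ~~ uniq [:: w0; w1; w2; w3; w4].
  move=> a01 a12 a23 a34; apply: contra nop5 => U.
  apply/existsP; exists w0; apply/existsP; exists w1; apply/existsP; exists w2.
  by apply/existsP; exists w3; apply/existsP; exists w4; apply/and5P.
have [/existsP[v0 /existsP[v1 /existsP[v2 /existsP[v3 /and4P[U v01 v12 v23]]]]]|nop4] :=
  boolP [exists w0 : G, exists w1 : G, exists w2 : G, exists w3 : G,
    [&& uniq [:: w0; w1; w2; w3], adj w0 w1, adj w1 w2 & adj w2 w3]]; last first.
  constructor 1; apply: star_of_no_path notri _ => w0 w1 w2 w3 a01 a12 a23.
  apply: contra nop4 => U.
  apply/existsP; exists w0; apply/existsP; exists w1; apply/existsP; exists w2.
  by apply/existsP; exists w3; apply/and4P.
(* From here on G is a double star with centres v1 and v2. *)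
have [v10 v21 v32] : [/\ adj v1 v0, adj v2 v1 & adj v3 v2] by split; rewrite adj_sym.
have [n13 n20] : v1 != v3 /\ v2 != v0 by split_hyps; split; neqs.
have leaf1 x y : adj v1 x -> x <> v2 -> adj x y -> y = v1.
  exact: (leaf_of_path notri nosq nop5 v12 v23 n13).
have leaf2 x y : adj v2 x -> x <> v1 -> adj x y -> y = v2.
  exact: (leaf_of_path notri nosq nop5 v21 v10 n20).
have allG : forall x, [|| x == v1, x == v2, adj v1 x | adj v2 x].
  apply: (connected_closed (x := v1)); first by rewrite eqxx.
  move=> x y /or4P[/eqP->|/eqP->|v1x|v2x] xy; first by rewrite xy !orbT.
  - by rewrite xy !orbT.
  - have [x2|/eqP nx2] := eqVneq x v2; first by rewrite -x2 xy !orbT.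
    by rewrite (leaf1 x y) ?eqxx.
  have [x1|/eqP nx1] := eqVneq x v1; first by rewrite -x1 xy !orbT.
  by rewrite (leaf2 x y) ?eqxx ?orbT.
have [/existsP[w' /and3P[v2w' nw'1 nw'3]]|only2] :=
  boolP [exists y, [&& adj v2 y, y != v1 & y != v3]]; last first.
  constructor 4; have adj2 y : adj v2 y -> y = v1 \/ y = v3.
    move=> v2y; have := existsPn only2 y; rewrite v2y /= negb_and !negbK.
    by case/orP=> /eqP; auto.
  apply: (@iso_Gamma _ v0 v1 v2 v3) => //.
    move=> x; case/or4P: (allG x) => [/eqP|/eqP->|v1x|/adj2[]]; auto.
  by move=> y; apply: leaf2 => //; split_hyps; congruence.
have [/existsP[w /and3P[v1w nw2 nw0]]|only1] :=
  boolP [exists y, [&& adj v1 y, y != v2 & y != v0]]; last first.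
  constructor 4; have adj1 y : adj v1 y -> y = v2 \/ y = v0.
    move=> v1y; have := existsPn only1 y; rewrite v1y /= negb_and !negbK.
    by case/orP=> /eqP; auto.
  apply: (@iso_Gamma _ v3 v2 v1 v0) => //.
  - by rewrite -(rev_uniq [:: v3; v2; v1; v0]).
  - move=> x; case/or4P: (allG x) => [/eqP->|/eqP|/adj1[]|v2x]; auto.
  by move=> y; apply: leaf1 => //; split_hyps; congruence.
constructor 2; apply: (@cherries_save_two _ Gc v1 v0 w v2 v3 w') => //.
have n1w := adj_neq v1w; have n2w' := adj_neq v2w'.
have nw3 : w != v3 by apply: contraTneq v1w => ->; apply: notri v12 v23.
have nw'0 : w' != v0.
  by apply: contraTneq v2w' => ->; rewrite adj_sym; apply: notri v01 v12.
have nww' : w != w' by apply: contraTneq v1w => ->; apply: notri v12 v2w'.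
by split_hyps; rewrite /= !inE; neqs.
Qed.

End Classification.

(** * The characterisation *)

Lemma path4_colorable (G : sgraph) :
  connected G -> iso G (path_graph 4) -> scf_colorable G 3.
Proof.
move=> Gc isoG; have := iso_card_edges isoG; rewrite card_edges_path => E4.
have [f [g fK gK] fA] := isoG.
pose v i : path_graph 4 := inord i.
have vE i : i < 5 -> v i = i :> nat by move=> ?; rewrite /v inordK.
have := @disjoint_edges_save_one G (g (v 0)) (g (v 1)) (g (v 2)) (g (v 3)) Gc.
rewrite E4; apply.
- rewrite (map_inj_uniq (can_inj gK) [:: v 0; v 1; v 2; v 3]) /= !inE.
  by rewrite -!val_eqE /= !vE.
- by rewrite -fA !gK /= /path_rel !vE.
- by rewrite -fA !gK /= /path_rel !vE.
Qed.

Lemma path4_ge3_colors (G : sgraph) k :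
  iso G (path_graph 4) -> scf_colorable G k -> 3 <= k.
Proof.
move=> [f [g fK gK] fA] /existsP[col scf_col].
pose v i : path_graph 4 := inord i.
have vE i : i < 5 -> v i = i :> nat by move=> ?; rewrite /v inordK.
have eqE i x : i < 5 -> (x == g (v i)) = (f x == i :> nat).
  by move=> lti; rewrite -(inj_eq (can_inj fK)) gK -val_eqE /= vE.
apply: (five_vertex_path_ge3_colors scf_col (v0 := g (v 0)) (v1 := g (v 1)) (v2 := g (v 2))
         (v3 := g (v 3)) (v4 := g (v 4))).
  rewrite (map_inj_uniq (can_inj gK) [:: v 0; v 1; v 2; v 3; v 4]) /= !inE.
  by rewrite -!val_eqE /= !vE.
all: move=> x /=; rewrite ?eqE // -fA gK /= /path_rel vE //.
all: by case: (f x) => [[|[|[|[|[|?]]]]] ?].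
Qed.

(* The subtraction m - 1 is taken in int, since it would be truncated in nat. *)
Theorem theorem4p7 (G : sgraph) (Gc : connected G) (m : nat)
    (Gm : #|edges G| = m) :
  (scfc Gc)%:Z%R = (m%:Z - 1)%R <->
  [\/ iso G (path_graph 3), iso G (path_graph 4) | 3 <= m /\ iso G (Gamma m)].
Proof.
apply: (iff_trans (B := m = (scfc Gc).+1)).
  split=> [/eqP|mE]; last apply/eqP;
    rewrite eq_sym GRing.subr_eq -PoszD eqz_nat addn1; first by move/eqP.
  by rewrite -mE.
rewrite /scfc; case: ex_minnP => n colG minG.
have GammaE : 3 <= m -> iso G (Gamma m) -> m = n.+1.
  move=> m3 isoG; rewrite -(prednK (ltnW (ltnW m3))); congr _.+1.
  apply/eqP; rewrite eqn_leq (Gamma_colors m3 isoG colG).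
  exact/minG/(Gamma_colorable Gc m3 isoG).
split=> [mE|[P3|P4|[m3 isoG]]]; last exact: GammaE; last first.
- have -> : m = 4 by rewrite -Gm (iso_card_edges P4) card_edges_path.
  congr _.+1; apply/eqP; rewrite eqn_leq (path4_ge3_colors P4 colG).
  exact/minG/path4_colorable.
- have m3 : m = 3 by rewrite -Gm (iso_card_edges P3) card_edges_path.
  by apply: GammaE; rewrite m3 //; apply: iso_trans P3 path3_Gamma.
have [[c [cP le_m]]|[k le_k colk]|P4|GG] := classification Gc.
- case/existsP: colG => col /degree_le_colors/(_ _ cP) le_n.
  by have := leq_trans le_m le_n; rewrite Gm mE ltnn.
- by have := leq_trans le_k (eq_leq Gm); rewrite mE ltnS ltnNge minG.
- by constructor 2.
- by constructor 3; rewrite -Gm.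
Qed.
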